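(* Let $A\in\mathbb{C}^{m\times n}$, $0\neq W\in\mathbb{C}^{n\times m}$, $k=\max\{\mathrm{Ind}(AW),\mathrm{Ind}(WA)\}$ and $q\in\mathbb{N}\cup\{0\}$. Then: (i) $A^{\diamond_q,W}=(WAW)^\dagger$ if $q=0$; (ii) $A^{\diamond_q,W}=A^{\diamond,W}$ (the $W$-weighted BT inverse of $A$) if $q=1$; (iii) $A^{\diamond_q,W}=A^{\mathrm{cep},W}$ (the $W$-weighted core-EP inverse of $A$) if either $q=\mathrm{Ind}(AW)$ or $q\ge k$.
   Context: $B^\dagger$ denotes the Moore-Penrose inverse and $P_B:=BB^\dagger$ the orthogonal projector onto the column space $\mathcal{R}(B)$. For a square matrix $B$, $B^0=I$ and $\mathrm{Ind}(B)$ is the smallest nonnegative integer $j$ with $\mathrm{rank}(B^j)=\mathrm{rank}(B^{j+1})$. The $W$-weighted $q$-BT inverse $A^{\diamond_q,W}$ is the unique $X\in\mathbb{C}^{m\times n}$ satisfying $XWAWX=X$, $XWA=(WAWP_{(AW)^q})^\dagger WA$, $AWX=AW(WAWP_{(AW)^q})^\dagger$; explicitly $A^{\diamond_q,W}=(WAWP_{(AW)^q})^\dagger$. The $W$-weighted BT inverse $A^{\diamond,W}$ is the unique $X\in\mathbb{C}^{m\times n}$ satisfying $XWAWX=X$, $XWA=[W(AW)^2(AW)^\dagger]^\dagger WA$, $AWX=AW[(WA)^2W(AW)^\dagger]^\dagger$; it is known that $A^{\diamond,W}=(WAWP_{AW})^\dagger$. The $W$-weighted core-EP inverse, here denoted $A^{\mathrm{cep},W}$,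 is defined by $A^{\mathrm{cep},W}=(WAWP_{(AW)^k})^\dagger$ with $k=\max\{\mathrm{Ind}(AW),\mathrm{Ind}(WA)\}$; it is the unique solution $X$ of $WAWX=P_{(WA)^k}$, $\mathcal{R}(X)\subseteq\mathcal{R}((AW)^k)$. *)

(* Defs.v *)
From mathcomp Require Import all_boot all_order all_algebra.
From mathcomp Require Import sesquilinear spectral.
From mathcomp Require Export reals complex.

Set Implicit Arguments.
Unset Strict Implicit.
Unset Printing Implicit Defensive.

Import Order.TTheory GRing.Theory Num.Theory.
Local Open Scope ring_scope.
Local Open Scope sesquilinear_scope.

Section MoorePenrose.
Variable C : numClosedFieldType.

Lemma trmxC_mul m n p (A : 'M[C]_(m, n)) (B : 'M[C]_(n, p)) :
  (A *m B)^t* = B^t* *m A^t*.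
Proof. by rewrite trmx_mul map_mxM. Qed.

Lemma mulmx_trmxC_eq0 m n (A : 'M[C]_(m, n)) : A *m A^t* = 0 -> A = 0.
Proof.
move=> A0; apply/matrixP => i j; rewrite mxE.
have /matrixP/(_ i i) := A0; rewrite !mxE => /psumr_eq0P s0.
have : A i j * A^t* j i = 0.
  by apply: s0 => // l _; rewrite !mxE mul_conjC_ge0.
by rewrite !mxE => /eqP; rewrite mul_conjC_eq0 => /eqP.
Qed.

Lemma gram_unitmx m n (A : 'M[C]_(m, n)) : row_free A -> A *m A^t* \in unitmx.
Proof.
move=> Afree; rewrite -row_free_unit -kermx_eq0; apply/eqP.
set K := kermx _; have K0 : K *m (A *m A^t*) = 0 by exact: mulmx_ker.
apply: (row_free_inj Afree); rewrite mul0mx; apply: mulmx_trmxC_eq0.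
by rewrite trmxC_mul mulmxA -[K *m A *m _]mulmxA K0 mul0mx.
Qed.

Lemma gram_trmxC m n (A : 'M[C]_(m, n)) : (A *m A^t*)^t* = A *m A^t*.
Proof. by rewrite trmxC_mul trmxCK. Qed.

Lemma invmx_trmxC n (A : 'M[C]_n) : (invmx A)^t* = invmx (A^t*).
Proof. by rewrite trmx_inv map_invmx. Qed.

(* The four Penrose equations, with M^t* the conjugate transpose. *)
Definition is_pinv m n (A : 'M[C]_(m, n)) : pred 'M[C]_(n, m) := fun X =>
  [&& A *m X *m A == A, X *m A *m X == X,
      (A *m X)^t* == A *m X & (X *m A)^t* == X *m A].

Lemma full_rank_pinv m n r (F : 'M[C]_(m, r)) (G : 'M[C]_(r, n)) :
    row_full F -> row_free G ->
  is_pinv (F *m G)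
    (G^t* *m invmx (G *m G^t*) *m (invmx (F^t* *m F) *m F^t*)).
Proof.
move=> Ffull Gfree; have Hfree : row_free (F^t*).
  by rewrite /row_free mxrank_map mxrank_tr; exact: Ffull.
have Gu := gram_unitmx Gfree; have Fu := gram_unitmx Hfree.
have Gh := gram_trmxC G; have Fh := gram_trmxC (F^t*).
rewrite trmxCK in Fu Fh.
set g := G *m G^t* in Gu Gh *; set f := F^t* *m F in Fu Fh *.
set X := (X in is_pinv _ X).
have AX : F *m G *m X = F *m invmx f *m F^t*.
  rewrite /X !mulmxA -[F *m G *m G^t*]mulmxA -/g.
  by rewrite -[F *m g *m _]mulmxA mulmxV // mulmx1.
have XA : X *m (F *m G) = G^t* *m invmx g *m G.
  rewrite /X !mulmxA -[_ *m F^t* *m F]mulmxA -/f.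
  by rewrite -[_ *m invmx f *m f]mulmxA mulVmx // mulmx1.
apply/and4P; split; apply/eqP.
- rewrite AX !mulmxA -[_ *m F^t* *m F]mulmxA -/f.
  by rewrite -[_ *m invmx f *m f]mulmxA mulVmx // mulmx1.
- rewrite XA /X !mulmxA -[_ *m G *m G^t*]mulmxA -/g.
  by rewrite -[_ *m invmx g *m g]mulmxA mulVmx // mulmx1.
- by rewrite AX !trmxC_mul trmxCK invmx_trmxC Fh mulmxA.
- by rewrite XA !trmxC_mul trmxCK invmx_trmxC Gh mulmxA.
Qed.

Lemma pinv_exists m n (A : 'M[C]_(m, n)) : exists X, is_pinv A X.
Proof.
have := full_rank_pinv (col_base_full A) (row_base_free A).
by rewrite mulmx_base => AX; eexists; exact: AX.
Qed.

Lemma pinv_unique m n (A : 'M[C]_(m, n)) X Y :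
  is_pinv A X -> is_pinv A Y -> X = Y.
Proof.
move=> /and4P[/eqP X1 /eqP X2 /eqP X3 /eqP X4].
move=> /and4P[/eqP Y1 /eqP Y2 /eqP Y3 /eqP Y4].
have AXY : A *m X = A *m Y.
  rewrite -X3 -{1}Y1 -[A *m Y *m A *m X]mulmxA trmxC_mul X3 Y3.
  by rewrite mulmxA X1.
have XAY : X *m A = Y *m A.
  by rewrite -X4 -{1}Y1 -[A *m Y *m A]mulmxA mulmxA trmxC_mul X4 Y4
             -mulmxA [A *m (X *m A)]mulmxA X1.
by rewrite -X2 -mulmxA AXY mulmxA XAY Y2.
Qed.

(* Moore-Penrose inverse: the unique solution of the Penrose equations. Not to
   be confused with the library's pinvmx, an arbitrary generalized inverse. *)
Definition pinv m n (A : 'M[C]_(m, n)) : 'M[C]_(n, m) :=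
  xchoose (pinv_exists A).

Lemma pinvP m n (A : 'M[C]_(m, n)) : is_pinv A (pinv A).
Proof. exact: xchooseP. Qed.

(* orthogonal projector onto the column space of B *)
Definition projmx m n (B : 'M[C]_(m, n)) : 'M[C]_m := B *m pinv B.

Lemma mxindex_exists n (B : 'M[C]_n) :
  exists j, \rank (B ^+ j) == \rank (B ^+ j.+1).
Proof.
have [|] := boolP [exists j : 'I_n.+1, \rank (B ^+ j) == \rank (B ^+ j.+1)].
  by case/existsP => j jP; exists j.
move=> /existsPn noj.
have dec j : (j <= n.+1)%N -> (\rank (B ^+ j) + j <= n)%N.
  elim: j => [|j IHj] jn; first by rewrite addn0 rank_leq_row.
  rewrite addnS; apply: leq_trans (IHj (ltnW jn)); rewrite ltn_add2r.
  rewrite ltn_neqAle eq_sym (noj (Ordinal jn)) /= exprS.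
  exact: mxrankM_maxr.
by have := dec _ (leqnn _); rewrite addnS ltnNge leq_addl.
Qed.

Definition mxindex n (B : 'M[C]_n) : nat := ex_minn (mxindex_exists B).

End MoorePenrose.

Section WeightedInverses.
Variables (C : numClosedFieldType) (m n : nat).
Variables (A : 'M[C]_(m, n)) (W : 'M[C]_(n, m)).

Lemma pinv_mulP (B : 'M[C]_(n, m)) (P : 'M[C]_m) :
  P *m P = P -> P^t* = P -> P *m pinv (B *m P) = pinv (B *m P).
Proof.
move=> PP Ph; have /and4P[_ /eqP X2 _ /eqP X4] := pinvP (B *m P).
set X := pinv _ in X2 X4 *.
by rewrite -X2 -X4 !trmxC_mul Ph !mulmxA PP.
Qed.

Lemma projmx_idem p (B : 'M[C]_(m, p)) : projmx B *m projmx B = projmx B.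
Proof.
by have /and4P[/eqP X1 _ _ _] := pinvP B; rewrite /projmx mulmxA X1.
Qed.

Lemma projmx_trmxC p (B : 'M[C]_(m, p)) : (projmx B)^t* = projmx B.
Proof. by have /and4P[_ _ /eqP] := pinvP B. Qed.

Definition is_wqBT (q : nat) : pred 'M[C]_(m, n) := fun X =>
  let Y := pinv (W *m A *m W *m projmx ((A *m W) ^+ q)) in
  [&& X *m W *m A *m W *m X == X,
      X *m W *m A == Y *m W *m A &
      A *m W *m X == A *m W *m Y].

Lemma wqBT_exists q : exists X, is_wqBT q X.
Proof.
exists (pinv (W *m A *m W *m projmx ((A *m W) ^+ q))).
apply/and3P; split=> //.
set P := projmx _; set X := pinv _.
have PX : P *m X = X.
  exact: pinv_mulP (projmx_idem _) (projmx_trmxC _).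
have /and4P[_ /eqP X2 _ _] : is_pinv (W *m A *m W *m P) X by exact: pinvP.
by apply/eqP; rewrite -{2}PX -{3}X2 !mulmxA.
Qed.

Lemma wqBT_unique q X Y : is_wqBT q X -> is_wqBT q Y -> X = Y.
Proof.
case/and3P=> /eqP X1 /eqP X2 /eqP X3 /and3P[/eqP Y1 /eqP Y2 /eqP Y3].
rewrite -X1 X2 -Y2 -!mulmxA [A *m (W *m X)]mulmxA X3 -Y3.
by rewrite !mulmxA Y1.
Qed.

(* weighted q-BT inverse: the unique solution of the system is_wqBT *)
Definition wqBT (q : nat) : 'M[C]_(m, n) := xchoose (wqBT_exists q).

Definition is_wBT : pred 'M[C]_(m, n) := fun X =>
  [&& X *m W *m A *m W *m X == X,
      X *m W *m A == pinv (W *m (A *m W) ^+ 2 *m pinv (A *m W)) *m W *m A &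
      A *m W *m X == A *m W *m pinv ((W *m A) ^+ 2 *m W *m pinv (A *m W))].

Lemma wBT_exists : exists X, is_wBT X.
Proof.
have [X XP] := wqBT_exists 1; exists X; move: XP.
rewrite /is_wBT /is_wqBT /projmx expr1 !expr2.
by rewrite -[(A *m W) * _]/(A *m W *m (A *m W))
           -[(W *m A) * _]/(W *m A *m (W *m A)) !mulmxA.
Qed.

Lemma wBT_unique X Y : is_wBT X -> is_wBT Y -> X = Y.
Proof.
case/and3P=> /eqP X1 /eqP X2 /eqP X3 /and3P[/eqP Y1 /eqP Y2 /eqP Y3].
rewrite -X1 X2 -Y2 -!mulmxA [A *m (W *m X)]mulmxA X3 -Y3.
by rewrite !mulmxA Y1.
Qed.

(* weighted BT inverse: the unique solution of the system is_wBT *)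
Definition wBT : 'M[C]_(m, n) := xchoose wBT_exists.

(* weighted core-EP inverse *)
Definition wcoreEP : 'M[C]_(m, n) :=
  let k := maxn (mxindex (A *m W)) (mxindex (W *m A)) in
  pinv (W *m A *m W *m projmx ((A *m W) ^+ k)).

End WeightedInverses.

(* Main.v *)
Require Import Defs.
From mathcomp Require Import all_boot all_order all_algebra.
From mathcomp Require Import reals complex.

Set Implicit Arguments.
Unset Strict Implicit.
Unset Printing Implicit Defensive.

Import Order.TTheory GRing.Theory Num.Theory.
Local Open Scope ring_scope.

(** All the inverses involved are values of one expression, the Moore-Penrose
    inverse of WAWP, where P is the orthogonal projector onto the column space
    of some power of AW: [wqBT_pinv] extracts this closed form from the system
    that characterizes the weighted q-BT inverse. The three claims then compare
    projectors.
    - For q = 0 the power is the identity, and so is its projector.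
    - For q = 1 the defining systems of the two inverses coincide, because
      W(AW)^2(AW)^+ and (WA)^2W(AW)^+ are both WAW times the projector onto the
      column space of AW.
    - Once the rank of (AW)^d equals that of (AW)^(d+1), the column spaces of
      the powers of AW are constant from d on ([projmx_expr_stable]). Both q and
      k are at least Ind(AW), so their projectors agree, and k is the exponent
      in the definition of the weighted core-EP inverse. *)

Section Projectors.
Variable C : numClosedFieldType.

Lemma projmx_mulK m n (B : 'M[C]_(m, n)) : projmx B *m B = B.
Proof. by have /and4P[/eqP] := pinvP B. Qed.

Lemma projmx1 m : projmx (1%:M : 'M[C]_m) = 1%:M.
Proof. by have := projmx_mulK (1%:M : 'M[C]_m); rewrite mulmx1. Qed.

(** Inclusion of column spaces makes both products of the two projectors equal
    to one of them: one product by direct computation, the other by taking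
    adjoints. Two opposite inclusions then identify the projectors. *)
Lemma projmx_eq m n p (B : 'M[C]_(m, n)) (D : 'M[C]_(m, p)) X Y :
  B = D *m X -> D = B *m Y -> projmx B = projmx D.
Proof.
move=> BD DB.
have PBD : projmx B *m projmx D = projmx D.
  by rewrite {2}/projmx {1}DB !mulmxA projmx_mulK -DB.
have PDB : projmx D *m projmx B = projmx B.
  by rewrite {2}/projmx {1}BD !mulmxA projmx_mulK -BD.
by rewrite -PDB -(projmx_trmxC B) -(projmx_trmxC D) -trmxC_mul PBD.
Qed.

End Projectors.

Section Powers.
Variable C : numClosedFieldType.

(** The column space of [B ^+ d.+1] always lies in that of [B ^+ d], so equal
    ranks force equality. The transposes turn column spaces into the row spaces
    that [submx] compares. *)
Lemma mxindex_factor n (B : 'M[C]_n) :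
  exists N, B ^+ mxindex B = B ^+ (mxindex B).+1 *m N.
Proof.
rewrite /mxindex; case: ex_minnP => d /eqP rk _.
have sub : ((B ^+ d.+1)^T <= (B ^+ d)^T)%MS.
  by rewrite exprSr -mulmxE trmx_mul submxMl.
have /submxP[D defD] : ((B ^+ d)^T <= (B ^+ d.+1)^T)%MS.
  by rewrite -(mxrank_leqif_sup sub) !mxrank_tr rk.
by exists D^T; apply: trmx_inj; rewrite trmx_mul trmxK.
Qed.

(** Left multiplication by powers of [B] propagates the factorization at
    exponent [d] to every larger exponent. *)
Lemma expr_factor n (B : 'M[C]_n) d N r :
  B ^+ d = B ^+ d.+1 *m N -> B ^+ d = B ^+ (d + r) *m N ^+ r.
Proof.
move=> defN; elim: r => [|r IHr]; first by rewrite addn0 expr0 mulmx1.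
have step : B ^+ (d + r) = B ^+ (d + r.+1) *m N.
  by rewrite [(d + r)%N]addnC exprD defN mulmxE mulrA -exprD addnS addnC -addnS.
by rewrite IHr step exprS -!mulmxE mulmxA.
Qed.

Lemma projmx_expr_stable n (B : 'M[C]_n) q :
  (mxindex B <= q)%N -> projmx (B ^+ q) = projmx (B ^+ mxindex B).
Proof.
move=> leq_q; have [N defN] := mxindex_factor B.
apply: (projmx_eq (X := B ^+ (q - mxindex B)) (Y := N ^+ (q - mxindex B))).
  by rewrite mulmxE -exprD subnKC.
by rewrite {1}(expr_factor (q - mxindex B) defN) subnKC.
Qed.

End Powers.

Section ClosedForms.
Variables (C : numClosedFieldType) (m n : nat).
Variables (A : 'M[C]_(m, n)) (W : 'M[C]_(n, m)).

Lemma wqBTP q : is_wqBT A W q (wqBT A W q).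
Proof. exact: xchooseP. Qed.

(** The second and third defining equations hold by reflexivity. The first is
    the outer-inverse Penrose equation, in which the projector is absorbed by
    the Moore-Penrose inverse. *)
Lemma wqBT_pinv q :
  wqBT A W q = pinv (W *m A *m W *m projmx ((A *m W) ^+ q)).
Proof.
apply: (wqBT_unique (wqBTP q)); set P := projmx _; set X := pinv _.
have PX : P *m X = X.
  by apply: pinv_mulP; [exact: projmx_idem | exact: projmx_trmxC].
have /and4P[_ /eqP XWX _ _] := pinvP (W *m A *m W *m P).
rewrite -/X in XWX.
by rewrite /is_wqBT -/P -/X !eqxx !andbT -{2}PX -{3}XWX !mulmxA.
Qed.

Lemma wqBT1 : wqBT A W 1 = wBT A W.
Proof.
apply: (@wBT_unique _ _ _ A W); last exact: xchooseP.
have := wqBTP 1; rewrite /is_wqBT /is_wBT /projmx expr1 !expr2.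
by rewrite -!mulmxE !mulmxA.
Qed.

End ClosedForms.

Theorem corollary2p6 (R : realType) (m n : nat)
    (A : 'M[R[i]]_(m, n)) (W : 'M[R[i]]_(n, m)) (hW : W != 0)
    (k : nat) (hk : k = maxn (mxindex (A *m W)) (mxindex (W *m A)))
    (q : nat) :
  [/\ q = 0%N -> wqBT A W q = pinv (W *m A *m W),
      q = 1%N -> wqBT A W q = wBT A W &
      q = mxindex (A *m W) \/ (k <= q)%N -> wqBT A W q = wcoreEP A W].
Proof.
split=> [-> | -> | q_large].
- by rewrite wqBT_pinv expr0 projmx1 mulmx1.
- exact: wqBT1.
have le_k : (mxindex (A *m W) <= k)%N by rewrite hk leq_maxl.
have le_q : (mxindex (A *m W) <= q)%N.
  by case: q_large => [-> // | /(leq_trans le_k)].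
by rewrite wqBT_pinv /wcoreEP -hk !projmx_expr_stable.
Qed.
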